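(* Fix $\mu_1,\mu_2\in\mathbb R$ and $\sigma_1,\sigma_2>0$. For $|\rho|<1$ let $(X_1,X_2)^\top$ be bivariate normal with mean $(\mu_1,\mu_2)^\top$ and covariance matrix having diagonal elements $\sigma_1^2,\sigma_2^2$ and off-diagonal element $\rho\sigma_1\sigma_2$, and let $R=\sqrt{X_1^2+X_2^2}$. As $\rho\to\pm1$, the limiting density of $R$ is $$f_R(r;\lambda,\varsigma,\varepsilon)=\sqrt{\frac2\pi}\,\frac r\varsigma\left(\frac{r^2-\varepsilon}{\varsigma}\right)^{-\frac12}\exp\left(-\frac{r^2-\varepsilon}{2\varsigma}-\frac\lambda2\right)\cosh\left(\sqrt{\frac{\lambda(r^2-\varepsilon)}{\varsigma}}\right)\mathbf 1[r>\sqrt\varepsilon],$$ where $\varsigma=\sigma_1^2+\sigma_2^2$, $\lambda=\varsigma^{-2}\{\mu_1^2\sigma_1^2+\mu_2^2\sigma_2^2+2\mu_1\mu_2\sigma_1\sigma_2\,\mathrm{sign}(\rho)\}$ and $\varepsilon=\varsigma^{-1}\{\mu_2^2\sigma_1^2+\mu_1^2\sigma_2^2-2\mu_1\mu_2\sigma_1\sigma_2\,\mathrm{sign}(\rho)\}$.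
   Context: $\mathbf 1[\cdot]$ is the indicator function. ''Limiting density'' means the density of the limiting distribution: for each of the two limits $\rho\to1$ (with $\mathrm{sign}(\rho)=1$) and $\rho\to-1$ (with $\mathrm{sign}(\rho)=-1$), $R$ converges in distribution to the law on $\mathbb R$ having the displayed density. *)

(* Defs.v *)
From HB Require Import structures.
From mathcomp Require Import all_boot all_order all_algebra.
From mathcomp Require Import all_classical all_reals all_analysis.
From mathcomp Require Import measurable_realfun.

Set Implicit Arguments.
Unset Strict Implicit.
Unset Printing Implicit Defensive.

Import Order.TTheory GRing.Theory Num.Theory.
Import numFieldNormedType.Exports.

Local Open Scope classical_set_scope.
Local Open Scope ring_scope.

Definition cosh {R : realType} (x : R) : R := (expR x + expR (- x)) / 2.

Definition col2 {R : realType} (x : R * R) : 'cV[R]_2 :=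
  \col_i (if i == 0 then x.1 else x.2).

Definition covmx2 {R : realType} (s1 s2 rho : R) : 'M[R]_2 :=
  \matrix_(i, j)
    (if i == j then (if i == 0 then s1 ^+ 2 else s2 ^+ 2) else rho * s1 * s2).

Definition binormal_pdf {R : realType} (m : 'cV[R]_2) (S : 'M[R]_2)
    (x : R * R) : R :=
  (2 * pi * Num.sqrt (\det S))^-1 *
  expR (- ((col2 x - m)^T *m invmx S *m (col2 x - m)) 0 0 / 2).

(* Nondegenerate bivariate normal law: S is meant to be positive definite. *)
Definition is_binormal {R : realType} d (T : measurableType d)
    (P : probability T R) (X : {RV P >-> (R * R)%type})
    (m : 'cV[R]_2) (S : 'M[R]_2) : Prop :=
  forall A : set (R * R), measurable A ->
    distribution P X A =
    (\int[lebesgue_measure \x lebesgue_measure]_(x in A)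
       (binormal_pdf m S x)%:E)%E.
Arguments is_binormal {R d T} P X m S.

Section euclidean_norm.
Context {R : realType} d (T : measurableType d) (P : probability T R).
Variable X : {RV P >-> (R * R)%type}.

Definition rvnorm (w : T) : R := Num.sqrt ((X w).1 ^+ 2 + (X w).2 ^+ 2).

Lemma measurable_rvnorm : measurable_fun [set: T] rvnorm.
Proof.
have mX : measurable_fun [set: T] X by exact: measurable_funPT.
apply: measurableT_comp.
- by apply: continuous_measurable_fun; exact: sqrt_continuous.
- by apply: measurable_funD; apply: measurable_funX; apply: measurableT_comp.
Qed.

HB.instance Definition _ :=
  isMeasurableFun.Build _ _ _ _ rvnorm measurable_rvnorm.

End euclidean_norm.

(* The random variables may live on different probability spaces. *)
Definition cvg_in_distribution {R : realType} {I : Type} (F : set_system I)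
    (d : I -> measure_display) (T : forall i, measurableType (d i))
    (P : forall i, probability (T i) R)
    (X : forall i, {RV (P i) >-> R}) (nu : probability R R) : Prop :=
  forall x : R, {for x, continuous (fun t : R => nu `]-oo, t]%classic)} ->
    cdf (X i) x @[i --> F] --> nu `]-oo, x]%classic.
Arguments cvg_in_distribution {R I} F {d T} P X nu.

Definition has_density {R : realType} (nu : probability R R) (f : R -> R) :=
  [/\ measurable_fun [set: R] f, forall x, 0 <= f x &
      forall A : set R, measurable A ->
        nu A = (\int[lebesgue_measure]_(x in A) (f x)%:E)%E].

Definition limiting_density {R : realType} {I : Type} (F : set_system I)
    (d : I -> measure_display) (T : forall i, measurableType (d i))
    (P : forall i, probability (T i) R)
    (X : forall i, {RV (P i) >-> R}) (f : R -> R) : Prop :=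
  exists nu : probability R R, has_density nu f /\ cvg_in_distribution F P X nu.
Arguments limiting_density {R I} F {d T} P X f.

Section parameters.
Context {R : realType}.
Variables mu1 mu2 sigma1 sigma2 rho : R.

Definition varsigma : R := sigma1 ^+ 2 + sigma2 ^+ 2.

Definition lambda : R := varsigma ^- 2 *
  (mu1 ^+ 2 * sigma1 ^+ 2 + mu2 ^+ 2 * sigma2 ^+ 2
   + 2 * mu1 * mu2 * sigma1 * sigma2 * Num.sg rho).

Definition epsilon : R := varsigma^-1 *
  (mu2 ^+ 2 * sigma1 ^+ 2 + mu1 ^+ 2 * sigma2 ^+ 2
   - 2 * mu1 * mu2 * sigma1 * sigma2 * Num.sg rho).

End parameters.

(* For r <= sqrt e the indicator vanishes, which makes the values of the real
   power and of the square root on nonpositive arguments irrelevant. *)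
Definition f_R {R : realType} (l v e r : R) : R :=
  Num.sqrt (2 / pi) * (r / v) * ((r ^+ 2 - e) / v) `^ (- (1 / 2))
  * expR (- ((r ^+ 2 - e) / (2 * v)) - l / 2)
  * cosh (Num.sqrt (l * (r ^+ 2 - e) / v))
  * \1_[set t | Num.sqrt e < t] r.

(* Main.v *)
Require Import Defs.
From HB Require Import structures.
From mathcomp Require Import all_boot all_order all_algebra.
From mathcomp Require Import all_classical all_reals all_analysis.
From mathcomp Require Import measurable_realfun ring lra.

Set Implicit Arguments.
Unset Strict Implicit.
Unset Printing Implicit Defensive.

Import Order.TTheory GRing.Theory Num.Theory.
Import numFieldNormedType.Exports.

Local Open Scope classical_set_scope.
Local Open Scope ring_scope.

(** Write s for the limit of the correlation rho, s = 1 or s = -1. Given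
    [X1 = x], the second coordinate of the bivariate normal law is normal with
    mean [mu2 + rho sigma2 / sigma1 (x - mu1)] and standard deviation
    [sigma2 sqrt (1 - rho^2)] ([binormal_pdfE]). As rho tends to s this
    conditional law concentrates at the point [line x] of the limiting
    regression line ([cvg_normal_prob_nbhs]), so the conditional probability of
    the disk of radius r tends to the indicator of [line_norm x <= r], for every
    x with [line_norm x <> r], that is for almost every x. Dominated
    convergence, with the density of X1 as dominating function, then gives
    convergence of the distribution function of R to that of [line_norm X1]
    ([cvg_integral_binormal_pdf]).

    It remains to compute the density of [line_norm X1]. In the standardized
    variable z = (x - mu1) / sigma1, the square of [line_norm x] is
    [varsigma (z + line_shift)^2 + line_offset] ([line_normE]), where
    [line_shift^2] is lambda and [line_offset] is epsilon. Hence, for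
    [sqrt line_offset < a], the event that [line_norm X1] lies between a and c
    consists of two disjoint intervals, one on each side of the point of the
    line that is closest to the origin ([line_norm_itvcc]). The two changes of
    variables [x = branch 1 r] and [x = branch (-1) r] turn the normal
    integrals over these intervals into integrals from a to c, and the two
    integrands add up to [f_R]: the two exponentials make the hyperbolic cosine
    ([f_R_branch]). The density may be unbounded near [sqrt line_offset], so
    the substitution is made on intervals that stay away from that point, which
    is enough to identify the law ([eq_measure_itvcc]). *)

(** * Identifying measures on R by compact intervals *)

Lemma itvNyo_bigcup_cc (R : realType) (e x : R) : e < x ->
  `]-oo, x[%classic = `]-oo, e] `|`
    \bigcup_n `[e + n.+1%:R^-1, x - n.+1%:R^-1]%classic.
Proof.
move=> ex; apply/seteqP; split=> y /=; rewrite !in_itv/=.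
- move=> yx; have [ye|ey] := leP y e; [by left|right].
  have [k ky] := ltr_add_invr ey; have [l lx] := ltr_add_invr yx.
  exists (maxn k l) => //=; rewrite in_itv/= lerBrDr.
  apply/andP; split.
    rewrite (le_trans _ (ltW ky))// lerD2l lef_pV2 ?posrE// ler_nat ltnS.
    exact: leq_maxl.
  rewrite (le_trans _ (ltW lx))// lerD2l lef_pV2 ?posrE// ler_nat ltnS.
  exact: leq_maxr.
- move=> [ye|[n _ /=]]; first exact: le_lt_trans ex.
  rewrite in_itv/= => /andP[_ yx]; apply: le_lt_trans yx _.
  by rewrite ltrBlDr ltrDl invr_gt0.
Qed.

(** Open rays generate the Borel sets and are stable under intersection, and a
    ray is, up to the null part on the left of e, an increasing union of compact
    intervals on the right of e. The point e itself is never an endpoint of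
    these intervals, so a density that is singular at e does no harm. *)
Lemma eq_measure_itvcc (R : realType)
    (m1 m2 : {measure set R -> \bar R}) (e : R) :
  (forall x, m1 `]-oo, x[%classic < +oo)%E ->
  m1 `]-oo, e]%classic = 0%E -> m2 `]-oo, e]%classic = 0%E ->
  (forall a b, e < a -> m1 `[a, b]%classic = m2 `[a, b]%classic) ->
  forall A, measurable A -> m1 A = m2 A.
Proof.
move=> m1oo m1e m2e m12 A mA.
apply: (@measure_unique _ R R (@RGenInftyO.G R)
  (fun n => `]-oo, n%:R[%classic) _ _ _ _ m1 m2 _ _ A mA).
- exact: RGenInftyO.measurableE.
- move=> _ _ [x ->] [y ->]; exists (Order.min x y).
  apply/seteqP; split=> z; rewrite /= !in_itv/= lt_min.
    by move=> [-> ->].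
  by move=> /andP[-> ->].
- by move=> n; exists n%:R.
- rewrite -subTset => x _; exists (Num.truncn x).+1 => //=.
  by rewrite in_itv/= truncnS_gt.
- move=> _ [x ->]; have [xe|ex] := leP x e.
    have sub : `]-oo, x[%classic `<=` `]-oo, e]%classic.
      by move=> y /=; rewrite !in_itv/= => /ltW/le_trans; apply.
    have m0 (m : {measure set R -> \bar R}) :
        m `]-oo, e]%classic = 0%E -> m `]-oo, x[%classic = 0%E.
      move=> me; apply/eqP; rewrite eq_le measure_ge0 andbT -me.
      by apply: le_measure => //; rewrite inE.
    by rewrite !m0.
  rewrite (itvNyo_bigcup_cc ex).
  set F := fun n => `[e + n.+1%:R^-1, x - n.+1%:R^-1 : R]%classic : set R.
  have mF n : measurable (F n : set R).
    exact: measurable_itv.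
  have mU : measurable (\bigcup_n F n : set R) by exact: bigcup_measurable.
  have ndF : nondecreasing_seq F.
    move=> k l kl; apply/subsetPset => y /=; rewrite /F/= !in_itv/=.
    have : l.+1%:R^-1 <= k.+1%:R^-1 :> R by rewrite lef_pV2 ?posrE// ler_nat ltnS.
    move: (l.+1%:R^-1) (k.+1%:R^-1) => u v H /andP[h1 h2].
    apply/andP; split; lra.
  have dis : `]-oo, e]%classic `&` \bigcup_n F n = set0.
    rewrite -subset0 => y [/=]; rewrite in_itv/= => ye [n _]; rewrite /F/= in_itv/=.
    have : 0 < n.+1%:R^-1 :> R by rewrite invr_gt0.
    by move: (n.+1%:R^-1) => u H /andP[/le_trans/(_ ye)]; rewrite gerDl leNgt H.
  have mE (m : {measure set R -> \bar R}) :
      m `]-oo, e]%classic = 0%E ->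
      m (`]-oo, e]%classic `|` \bigcup_n F n) = m (\bigcup_n F n).
    move=> me; rewrite measureU//; first by rewrite [X in (X + _)%E]me add0e.
  rewrite !mE//.
  have c1 := nondecreasing_cvg_mu (mu := m1) mF mU ndF.
  have c2 := nondecreasing_cvg_mu (mu := m2) mF mU ndF.
  have mm n : m1 (F n) = m2 (F n) by apply: m12; rewrite ltrDl invr_gt0.
  apply: (cvg_unique _ c1) => //; apply: cvg_trans c2.
  by apply: near_eq_cvg; near=> n; rewrite /= mm.
Unshelve. all: by end_near. Qed.

Section density_measure.
Context (R : realType) (f : R -> R).
Hypotheses (mf : measurable_fun [set: R] f) (f0 : forall x, 0 <= f x).

Definition density_measure (A : set R) : \bar R :=
  (\int[lebesgue_measure]_(x in A) (f x)%:E)%E.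

Let density_measure0 : density_measure set0 = 0%E.
Proof. exact: integral_set0. Qed.

Let density_measure_ge0 A : (0 <= density_measure A)%E.
Proof. by apply: integral_ge0 => x _; rewrite lee_fin. Qed.

Let density_measure_sigma_additive : semi_sigma_additive density_measure.
Proof.
move=> /= A mA tA mUA.
rewrite /density_measure ge0_integral_bigcup//=.
- apply: is_cvg_ereal_nneg_natsum_cond => n _ _.
  by apply: integral_ge0 => x _; rewrite lee_fin.
- by apply: measurable_funTS; exact/measurable_EFinP.
- by move=> x _; rewrite lee_fin.
Qed.

HB.instance Definition _ := isMeasure.Build _ _ _ density_measure
  density_measure0 density_measure_ge0 density_measure_sigma_additive.

(** The form in which the limiting density is checked: only compact intervals on
    the right of e have to be computed. *)
Lemma has_density_itvcc (nu : probability R R) (e : R) :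
  nu `]-oo, e]%classic = 0%E -> (forall x, x <= e -> f x = 0) ->
  (forall a b, e < a -> nu `[a, b]%classic =
    (\int[lebesgue_measure]_(x in `[a, b]) (f x)%:E)%E) ->
  has_density nu f.
Proof.
move=> nue fe nuab; split => // A mA.
apply: (@eq_measure_itvcc R nu density_measure e) => //.
- by move=> x; rewrite (le_lt_trans (probability_le1 _ _))// ltry.
- apply: integral0_eq => x; rewrite /= in_itv/= => xe.
  by rewrite fe.
Qed.
End density_measure.

(** * Concentration of normal laws with vanishing variance *)

Lemma normal_peakE (R : realType) (s : R) :
  0 < s -> normal_peak s = (s * Num.sqrt (pi *+ 2))^-1.
Proof.
by move=> s0; rewrite /normal_peak -mulrnAr sqrtrM ?sqr_ge0// sqrtr_sqr gtr0_norm.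
Qed.

(** Standardization of a normal law, restricted to intervals centered at the
    mean. *)
Lemma normal_prob_itv_scale (R : realType) (m t k : R) : 0 < t -> 0 <= k ->
  normal_prob m t `[m - t * k, m + t * k]%classic =
  normal_prob 0 1 `[- k, k]%classic.
Proof.
move=> t0 k0; rewrite /normal_prob.
pose F := fun z : R => m + t * z.
have dF (z : R) : is_derive z 1 F t.
  rewrite /F; apply: is_derive_eq.
  by rewrite add0r /GRing.scale/= mulr1 mul1r.
have F'E : F^`()%classic = cst t.
  by apply/funext => z; rewrite derive1E derive_val.
have := @integration_by_substitution_increasing R F (normal_pdf m t) (- k) k.
rewrite /F mulrN => ->.
- apply: eq_integral => z _; congr EFin.
  rewrite -/F !fctE F'E /= /F !normal_pdfE ?gt_eqF//.
  rewrite /normal_fun !normal_peakE// addrAC subrr add0r subr0.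
  rewrite expr1n mul1r -mulrA [_ * t]mulrC mulrA; congr (_ * expR _).
    by rewrite invfM mulrAC mulVf ?gt_eqF// mul1r.
  rewrite exprMn -(mulr_natr (t ^+ 2)) !mulNr -mulr_natr mul1r.
  have tt : t ^+ 2 != 0 by rewrite sqrf_eq0 gt_eqF.
  by congr (- _); field; rewrite gt_eqF.
- lra.
- by move=> x y _ _ xy; rewrite ltrD2l ltr_pM2l.
- by rewrite -/F F'E => ? _; exact: cvg_cst.
- by rewrite -/F F'E; exact: is_cvg_cst.
- by rewrite -/F F'E; exact: is_cvg_cst.
- have cF (z : R) : {for z, continuous F}.
    by apply/differentiable_continuous/derivable1_diffP.
  split => [z _|  |].
  + by [].
  + by apply: cvg_at_right_filter; exact: cF.
  + by apply: cvg_at_left_filter; exact: cF.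
- apply: continuous_subspaceT; apply: continuous_normal_pdf.
  by rewrite gt_eqF.
Qed.

Lemma cvg_normal_prob_itv (R : realType) :
  normal_prob 0 1 `[- n%:R, n%:R : R]%classic @[n --> \oo] --> 1%E.
Proof.
rewrite -(@probability_setT _ _ _ (normal_prob (0 : R) 1)).
have UT : \bigcup_n `[- n%:R, n%:R : R]%classic = setT.
  rewrite -subTset => x _; exists (Num.truncn `|x|).+1 => //=.
  by rewrite in_itv/= -ler_norml ltW// truncnS_gt.
rewrite -UT; apply: nondecreasing_cvg_mu => //.
  by apply: bigcup_measurable.
move=> k l kl; apply/subsetPset => x /=; rewrite !in_itv/= -!ler_norml.
by move=> /le_trans; apply; rewrite ler_nat.
Qed.

Lemma ler_dist1_fine (R : realType) (p q : \bar R) (e : R) :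
  (p <= 1)%E -> (q <= p)%E -> p \is a fin_num -> q \is a fin_num ->
  `|1 - fine q| <= e -> `|1 - fine p| <= e.
Proof.
case: p q => [p| |] [q| |]//; rewrite !lee_fin /= => p1 qp _ _.
by rewrite !ger0_norm ?subr_ge0 ?(le_trans qp)// => /(le_trans _); apply; lra.
Qed.

(** For each fixed k the interval of k standard deviations around the mean is
    eventually contained in the neighborhood B, and its mass does not depend on
    n; that mass tends to 1 as k grows. *)
Lemma cvg_normal_prob_nbhs (R : realType) (m t : R^nat) (m0 : R) (B : set R) :
  (forall n, 0 < t n) -> t @ \oo --> 0 -> m @ \oo --> m0 ->
  measurable B -> nbhs m0 B ->
  normal_prob (m n) (t n) B @[n --> \oo] --> 1%E.
Proof.
move=> t0 ct cm mB /nbhs_ballP[d /= d0 dB].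
apply/fine_cvgP; split.
  by near=> n; exact: fin_num_measure.
apply/cvgrPdist_le => e e0.
have /fine_cvgP[_ /cvgrPdist_le/(_ e e0)[k _ ek]] := @cvg_normal_prob_itv R.
have {}ek := ek k (leqnn k); rewrite /= in ek.
near=> n.
have sub : `[m n - t n * k%:R, m n + t n * k%:R]%classic `<=` B.
  move=> y /=; rewrite in_itv/= => /andP[y1 y2]; apply: dB => /=.
  rewrite /ball/=.
  have h1 : `|m0 - m n| < d / 2.
    by near: n; move/cvgrPdist_lt : cm; apply; rewrite divr_gt0.
  have h2 : t n * k%:R < d / 2.
    near: n.
    have ctk : t n * k%:R @[n --> \oo] --> 0.
      rewrite -(mul0r (k%:R : R)); apply: cvgM => //; exact: cvg_cst.
    have /(cvgr_lt 0)/(_ (d/2)) := ctk.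
    by apply; rewrite divr_gt0.
  move: h1; rewrite !ltr_norml => /andP[h1 h1']; apply/andP; split; lra.
have p1 : (normal_prob (m n) (t n) B <= 1)%E by exact: probability_le1.
pose I : set R := `[- k%:R, k%:R : R]%classic.
have p2 : (normal_prob 0%R 1%R I <= normal_prob (m n) (t n) B)%E.
  by rewrite /I -(@normal_prob_itv_scale _ (m n) (t n))//; apply: le_measure => //;
     rewrite inE.
have f1 := fin_num_measure (normal_prob (m n) (t n)) _ mB.
have f2 := fin_num_measure (normal_prob (0 : R) 1) _
  (measurable_itv `[- k%:R, k%:R] : measurable I).
by move: p1 p2 f1 f2 ek; exact: ler_dist1_fine.
Unshelve. all: by end_near. Qed.

Lemma cvg_normal_prob_nbhsC (R : realType) (m t : R^nat) (m0 : R) (B : set R) :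
  (forall n, 0 < t n) -> t @ \oo --> 0 -> m @ \oo --> m0 ->
  measurable B -> nbhs m0 (~` B) ->
  normal_prob (m n) (t n) B @[n --> \oo] --> 0%E.
Proof.
move=> t0 ct cm mB BC.
have c1 := cvg_normal_prob_nbhs t0 ct cm (measurableC mB) BC.
have h : (1 - normal_prob (m n) (t n) (~` B))%E @[n --> \oo] --> (1 - 1)%E.
  by apply: cvgeB => //; exact: cvg_cst.
rewrite subee// in h; apply: cvg_trans h; apply: near_eq_cvg; near=> n.
rewrite -[in RHS](setCK B) [RHS]probability_setC//.
exact: measurableC.
Unshelve. all: by end_near. Qed.

(** * Disintegration of the bivariate normal law *)

Lemma invmx_covmx2 (R : realType) (s1 s2 rho : R) :
  s1 != 0 -> s2 != 0 -> 1 - rho ^+ 2 != 0 ->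
  invmx (covmx2 s1 s2 rho) = \matrix_(i, j)
    ((if i == j then (if i == 0 then (s1 ^+ 2)^-1 else (s2 ^+ 2)^-1)
     else - rho / (s1 * s2)) / (1 - rho ^+ 2)) :> 'M[R]_2.
Proof.
move=> s10 s20 r0; set B := (X in _ = X).
have SB : covmx2 s1 s2 rho *m B = 1%:M.
  apply/matrixP => i j; rewrite !mxE !big_ord_recl big_ord0 !mxE.
  case: i => [[|[|//]] i]; case: j => [[|[|//]] j]; rewrite /=;
    by field; rewrite ?s10 ?s20 ?r0.
have [US _] := mulmx1_unit SB.
by rewrite -[RHS](mulKmx US) SB mulmx1.
Qed.

Lemma det_covmx2 (R : realType) (s1 s2 rho : R) :
  \det (covmx2 s1 s2 rho) = (s1 * s2) ^+ 2 * (1 - rho ^+ 2).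
Proof. 
rewrite (expand_det_row _ ord0) !big_ord_recl big_ord0 /cofactor !det_mx11 !mxE.
by rewrite /=; ring.
 Qed.

(** Completing the square in b; the left-hand side is the exponent of the
    bivariate density with the inverse covariance matrix written out. *)
Lemma bivariate_quadratic_form (F : realFieldType) (a b s1 s2 rho : F) :
  s1 != 0 -> s2 != 0 -> 1 - rho ^+ 2 != 0 ->
  - ((a * (s1 ^- 2 / (1 - rho ^+ 2)) +
      (b * (- rho / (s1 * s2) / (1 - rho ^+ 2)) + 0)) * a +
     ((a * (- rho / (s1 * s2) / (1 - rho ^+ 2)) +
       (b * (s2 ^- 2 / (1 - rho ^+ 2)) + 0)) * b + 0)) / 2 =
  - a ^+ 2 / (s1 ^+ 2 *+ 2) +
  - (b - rho * s2 / s1 * a) ^+ 2 / (s2 ^+ 2 * (1 - rho ^+ 2) *+ 2).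
Proof.
by move=> s10 s20 r0; field; rewrite s10 s20 r0.
Qed.

(** Marginal density of the first coordinate times conditional density of the
    second one. *)
Lemma binormal_pdfE (R : realType) (m1 m2 s1 s2 rho : R) (x : R * R) :
  0 < s1 -> 0 < s2 -> `|rho| < 1 ->
  binormal_pdf (col2 (m1, m2)) (covmx2 s1 s2 rho) x =
  normal_pdf m1 s1 x.1 *
  normal_pdf (m2 + rho * s2 / s1 * (x.1 - m1))
    (s2 * Num.sqrt (1 - rho ^+ 2)) x.2.
Proof.
move=> s10 s20 rho1.
have r0 : 0 < 1 - rho ^+ 2 by rewrite subr_gt0 -real_normK ?num_real// expr_lt1.
have q0 : 0 < Num.sqrt (1 - rho ^+ 2) by rewrite sqrtr_gt0.
rewrite !normal_pdfE ?gt_eqF ?mulr_gt0// /binormal_pdf /normal_fun.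
rewrite !normal_peakE ?mulr_gt0//.
rewrite invmx_covmx2 ?gt_eqF// det_covmx2 mulrACA -expRD; congr (_ * expR _).
  rewrite -invfM; congr _^-1.
  rewrite sqrtrM ?sqr_ge0// sqrtr_sqr gtr0_norm ?mulr_gt0//.
  have -> : 2 * pi = Num.sqrt (pi *+ 2) ^+ 2 :> R.
    by rewrite sqr_sqrtr ?mulr_natl// mulrn_wge0// pi_ge0.
  by ring.
rewrite !mxE !big_ord_recl big_ord0 !mxE !big_ord_recl !big_ord0 !mxE /=.
rewrite [(s2 * _) ^+ 2]exprMn sqr_sqrtr ?(ltW r0)//.
rewrite [x.2 - (m2 + _)](_ : _ = x.2 - m2 - rho * s2 / s1 * (x.1 - m1)).
  by apply: bivariate_quadratic_form; rewrite gt_eqF.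
by rewrite opprD addrA.
Qed.

(** The conditional mean moves with the first coordinate; centering the normal
    density reduces joint measurability to that of a single fixed density. *)
Lemma measurable_conditional_pdf (R : realType) (m1 m2 s1 c t : R) :
  0 < s1 -> 0 < t ->
  measurable_fun [set: R * R] (fun x : R * R =>
    normal_pdf m1 s1 x.1 * normal_pdf (m2 + c * (x.1 - m1)) t x.2).
Proof.
move=> s10 t0; apply: measurable_funM.
  by apply: measurableT_comp => //; exact: measurable_normal_pdf.
rewrite (_ : (fun _ => _) = (fun x : R * R =>
    normal_pdf 0 t (x.2 - (m2 + c * (x.1 - m1))))); last first.
  apply/funext => x; rewrite !normal_pdfE ?gt_eqF//.
  by rewrite normal_fun_center.
apply: (measurableT_comp (measurable_normal_pdf 0 t)) => //.
apply: measurable_funB => //; apply: measurable_funD => //.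
apply: measurable_funM => //; exact: measurable_funB.
Qed.

Section disintegration.
Context (R : realType) (m1 m2 s1 c t : R) (A : set (R * R)).
Hypotheses (s10 : 0 < s1) (t0 : 0 < t) (mA : measurable A).

Let f (x : R * R) : \bar R :=
  ((normal_pdf m1 s1 x.1 * normal_pdf (m2 + c * (x.1 - m1)) t x.2)
   * \1_A x)%:E.

Let mf : measurable_fun [set: R * R] f.
Proof.
apply/measurable_EFinP; apply: measurable_funM.
  exact: measurable_conditional_pdf.
exact: measurable_indic.
Qed.

Let f0 x : (0 <= f x)%E.
Proof. by rewrite lee_fin !mulr_ge0 ?normal_pdf_ge0. Qed.

Let FE x : (\int[lebesgue_measure]_y f (x, y) =
  (normal_pdf m1 s1 x)%:E *
  normal_prob (m2 + c * (x - m1)) t (xsection A x))%E.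
Proof.
rewrite /normal_prob [in RHS]integral_mkcond -ge0_integralZl//.
- apply: eq_integral => y _; rewrite /f /= -mulrA EFinM; congr (_ * _)%E.
  rewrite restrict_EFin /= patchE; congr EFin.
  rewrite indicE mem_xsection; case: ifP => _; by rewrite ?mulr1 ?mulr0.
- apply/(measurable_restrictT _ _).1 => //; first exact: measurable_xsection.
  apply: measurable_funTS; apply/measurable_EFinP; exact: measurable_normal_pdf.
- by move=> y _; apply: erestrict_ge0 => z _; rewrite lee_fin normal_pdf_ge0.
- by rewrite lee_fin normal_pdf_ge0.
Qed.

Lemma measurable_conditional_prob : measurable_fun [set: R] (fun x : R =>
  (normal_pdf m1 s1 x)%:E *
  normal_prob (m2 + c * (x - m1)) t (xsection A x))%E.
Proof.
have := @measurable_fun_fubini_tonelli_F _ _ _ _ R lebesgue_measure f mf f0.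
by apply: eq_measurable_fun => x _; exact: FE.
Qed.

(** Tonelli: the mass of a region is the average over the first coordinate of
    the conditional mass of its vertical sections. *)
Lemma integral_conditional_prob :
  (\int[lebesgue_measure \x lebesgue_measure]_(x in A)
    (normal_pdf m1 s1 x.1 * normal_pdf (m2 + c * (x.1 - m1)) t x.2)%:E =
  \int[lebesgue_measure]_x ((normal_pdf m1 s1 x)%:E *
    normal_prob (m2 + c * (x - m1)) t (xsection A x)))%E.
Proof.
rewrite integral_mkcond.
transitivity (\int[lebesgue_measure \x lebesgue_measure]_x f x)%E.
  apply: eq_integral => x _; rewrite restrict_EFin /= patchE /f indicE.
  by case: ifP => _; rewrite ?mulr1 ?mulr0.
rewrite fubini_tonelli1//.
by apply: eq_integral => x _; exact: FE.
Qed.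

End disintegration.

(** * Limit of the bivariate integrals *)

Section degenerate_limit.
Context (R : realType) (m1 m2 s1 s2 s : R) (N : R * R -> R).
Hypotheses (s10 : 0 < s1) (s20 : 0 < s2) (ss : s ^+ 2 = 1).
Hypotheses (cN2 : forall x, continuous (fun y => N (x, y)))
  (mN : measurable_fun [set: R * R] N).
Variables (u : R^nat).
Hypotheses (u1 : forall n, `|u n| < 1) (us : u @ \oo --> s).

Let L (x : R) := m2 + s * s2 / s1 * (x - m1).

Let t n := s2 * Num.sqrt (1 - u n ^+ 2).

Let t0 n : 0 < t n.
Proof.
rewrite mulr_gt0// sqrtr_gt0 subr_gt0 -real_normK ?num_real//.
by rewrite expr_lt1.
Qed.

Let ct : t @ \oo --> 0.
Proof.
rewrite -(mulr0 s2); apply: cvgM; first exact: cvg_cst.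
rewrite -(@sqrtr0 R) -(subrr (s ^+ 2)) {1}ss.
apply: (cvg_comp _ Num.sqrt); last exact: sqrt_continuous.
apply: cvgB; first exact: cvg_cst.
rewrite expr2; under eq_fun do rewrite expr2; exact: cvgM.
Qed.

Let cm x : (m2 + u n * s2 / s1 * (x - m1)) @[n --> \oo] --> L x.
Proof.
apply: cvgD; first exact: cvg_cst.
apply: cvgM; last exact: cvg_cst.
apply: cvgM; last exact: cvg_cst.
by apply: cvgM => //; exact: cvg_cst.
Qed.


(** Off the null set where [N (x, L x) = r], the point [L x] is either interior
    to the section at x of the sublevel set or exterior to it, so the
    conditional mass of that section tends to 1 or to 0. *)
Lemma cvg_integral_binormal_pdf (r : R) :
  lebesgue_measure [set x | N (x, L x) = r] = 0%E ->
  (\int[lebesgue_measure \x lebesgue_measure]_(x in [set x | (N x <= r)%R])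
    (binormal_pdf (col2 (m1, m2)) (covmx2 s1 s2 (u n)) x)%:E)%E @[n --> \oo]
  --> normal_prob m1 s1 [set x | N (x, L x) <= r].
Proof.
move=> Nr0.
pose A := [set x | N x <= r].
have mA : measurable A.
  rewrite -[A]setTI (_ : A = N @^-1` `]-oo, r]%classic).
    by apply: mN => //; exact: measurable_itv.
  by apply/seteqP; split => x; rewrite /A /= in_itv.
pose K n x := normal_prob (m2 + u n * s2 / s1 * (x - m1)) (t n) (xsection A x).
have KE n : (\int[lebesgue_measure \x lebesgue_measure]_(x in A)
    (binormal_pdf (col2 (m1, m2)) (covmx2 s1 s2 (u n)) x)%:E)%E =
    (\int[lebesgue_measure]_x ((normal_pdf m1 s1 x)%:E * K n x))%E.
  rewrite -integral_conditional_prob//; apply: eq_integral => x _.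
  by rewrite binormal_pdfE.
rewrite (_ : (fun _ => _) = (fun n =>
   \int[lebesgue_measure]_x ((normal_pdf m1 s1 x)%:E * K n x))%E); last first.
  by apply/funext => n; exact: KE.
pose B := [set x | N (x, L x) <= r].
have mNL : measurable_fun [set: R] (fun x => N (x, L x)).
  apply: (measurableT_comp mN); apply/measurable_fun_pair => //.
  by apply: measurable_funD => //; apply: measurable_funM => //; exact: measurable_funB.
have mB : measurable B.
  rewrite -[B]setTI (_ : B = (fun x => N (x, L x)) @^-1` `]-oo, r]%classic).
    by apply: mNL => //; exact: measurable_itv.
  by apply/seteqP; split => x; rewrite /B /= in_itv.
rewrite (_ : normal_prob m1 s1 _ = \int[lebesgue_measure]_x
    ((normal_pdf m1 s1 x)%:E * (\1_B x)%:E))%E; last first.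
  rewrite /normal_prob integral_mkcond; apply: eq_integral => x _.
  rewrite restrict_EFin /= patchE -EFinM indicE.
  by case: ifP => _; rewrite ?mulr1 ?mulr0.

have mf n : measurable_fun [set: R] (fun x => (normal_pdf m1 s1 x)%:E * K n x)%E.
  exact: measurable_conditional_prob.
have mg : measurable_fun [set: R]
    (fun x => (normal_pdf m1 s1 x)%:E * (\1_B x)%:E)%E.
  apply: emeasurable_funM; apply/measurable_EFinP.
    exact: measurable_normal_pdf.
  exact: measurable_indic.
have cK x : N (x, L x) <> r -> K ^~ x @ \oo --> (\1_B x)%:E.
  move=> Nr; have mx : measurable (xsection A x) by exact: measurable_xsection.
  have [Nlt|Ngt] : N (x, L x) < r \/ r < N (x, L x).
    by move/eqP : Nr; rewrite neq_lt => /orP.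
  - rewrite indicE mem_set /= ?mulr1n; last exact: ltW.
    apply: (@cvg_normal_prob_nbhs _ _ t (L x)) => //.
    have := @cN2 x (L x).
    move=> /(cvgr_lt (N (x, L x)))/(_ r Nlt).
    apply: filterS => y /= yr.
    by rewrite /xsection /= inE /A /= ltW.
  - rewrite indicE memNset; last by rewrite /B /= => /(lt_le_trans Ngt); rewrite ltxx.
    apply: (@cvg_normal_prob_nbhsC _ _ t (L x)) => //.
    have := @cN2 x (L x).
    move=> /(cvgr_gt (N (x, L x)))/(_ r Ngt).
    apply: filterS => y /= yr.
    by rewrite /xsection /= inE /A /=; apply/negP; rewrite -ltNge.
have mE : measurable [set x | N (x, L x) = r].
  rewrite -[X in measurable X]setTI
    (_ : [set x | N (x, L x) = r] = (fun x => N (x, L x)) @^-1` [set r]).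
    by apply: mNL => //; exact: measurable_set1.
  by apply/seteqP; split.
have ae_cvg : {ae lebesgue_measure, forall x, [set: R] x ->
    (fun n => (normal_pdf m1 s1 x)%:E * K n x)%E @ \oo -->
    ((normal_pdf m1 s1 x)%:E * (\1_B x)%:E)%E}.
  exists [set x | N (x, L x) = r]; split => //.
  move=> x /= Hx; apply: contrapT => Nr; apply: Hx => _.
  by apply: cvgeZl => //; exact: cK.
have dom : {ae lebesgue_measure, forall x n, [set: R] x ->
    (`|(normal_pdf m1 s1 x)%:E * K n x| <= (normal_pdf m1 s1 x)%:E)%E}.
  apply: aeW => x n _; rewrite abseM /= ger0_norm ?normal_pdf_ge0//.
  rewrite gee0_abs ?measure_ge0// -[leRHS]mule1.
  rewrite lee_wpmul2l ?lee_fin ?normal_pdf_ge0//.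
  exact/probability_le1/measurable_xsection.
by have [] := @dominated_convergence _ (measurableTypeR R) R
  lebesgue_measure setT measurableT _ _ _ mf mg ae_cvg
  (integrable_normal_pdf m1 s1) dom.
Qed.
End degenerate_limit.

(** * Change of variables away from an endpoint *)

Section substitution.
Context (R : realType).
Implicit Types (F G : R -> R) (e a c : R).

(** The substitution is regular on the open ray beyond e, and its derivative may
    blow up at e. *)
Lemma integration_by_substitution_itv_gt F (F' : R -> R) G e a c :
  (forall x, e < x -> is_derive x 1 F (F' x)) ->
  (forall x, e < x -> F' y @[y --> x] --> F' x) ->
  (forall x y, e < x -> x < y -> F x < F y) ->
  continuous G -> e < a -> a <= c ->
  (\int[lebesgue_measure]_(x in `[F a, F c]) (G x)%:E =
   \int[lebesgue_measure]_(x in `[a, c]) (G (F x) * F' x)%:E)%E.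
Proof.
move=> dF cF' incF cG ea ac.
have F'E x : e < x -> F^`()%classic x = F' x.
  by move=> ex; rewrite derive1E; exact: (@derive_val _ _ _ _ _ _ _ (dF x ex)).
have cF'1 x : e < x -> F^`()%classic y @[y --> x] --> F^`()%classic x.
  move=> ex; rewrite F'E//; apply: cvg_trans (cF' x ex); apply: near_eq_cvg.
  near=> y; rewrite F'E//; near: y; exact: lt_nbhsr.
have cF x : e < x -> F y @[y --> x] --> F x.
  move=> ex; apply: differentiable_continuous.
  by apply/derivable1_diffP; exact: (@ex_derive _ _ _ _ _ _ _ (dF x ex)).
have ec : e < c by exact: lt_le_trans ac.
rewrite integration_by_substitution_increasing//.
- apply: eq_integral => x; rewrite inE/= in_itv/= => /andP[ax _].
  by rewrite /= !fctE F'E// (lt_le_trans ea).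
- move=> x y; rewrite !in_itv/= => /andP[ax _] _; apply: incF.
  exact: lt_le_trans ax.
- move=> x; rewrite in_itv/= => /andP[ax _]; apply: cF'1.
  exact: lt_trans ax.
- apply/cvg_ex; exists (F^`()%classic a).
  exact/cvg_at_right_filter/cF'1.
- apply/cvg_ex; exists (F^`()%classic c).
  exact/cvg_at_left_filter/cF'1.
- split.
  + move=> x; rewrite in_itv/= => /andP[ax _].
    exact: (@ex_derive _ _ _ _ _ _ _ (dF x (lt_trans ea ax))).
  + exact/cvg_at_right_filter/cF.
  + exact/cvg_at_left_filter/cF.
- exact: continuous_subspaceT.
Unshelve. all: by end_near. Qed.

Lemma integration_by_substitution_itv_gtN F (F' : R -> R) G e a c :
  (forall x, e < x -> is_derive x 1 F (F' x)) ->
  (forall x, e < x -> F' y @[y --> x] --> F' x) ->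
  (forall x y, e < x -> x < y -> F y < F x) ->
  continuous G -> e < a -> a <= c ->
  (\int[lebesgue_measure]_(x in `[F c, F a]) (G x)%:E =
   \int[lebesgue_measure]_(x in `[a, c]) (G (F x) * - F' x)%:E)%E.
Proof.
move=> dF cF' decF cG ea ac.
have Fca : F c <= F a.
  by move: ac; rewrite le_eqVlt => /predU1P[->//|ac]; exact/ltW/decF.
transitivity (\int[lebesgue_measure]_(x in `[(- F a)%R, (- F c)%R])
    ((G \o -%R) x)%:E)%E.
  rewrite (integration_by_substitution_oppr (G := G \o -%R)) ?opprK ?lerN2//.
    by apply: eq_integral => x _ /=; rewrite opprK.
  apply: continuous_subspaceT => x; apply: continuous_comp; last exact: cG.
  exact: opp_continuous.
apply: etrans (@integration_by_substitution_itv_gt (fun x => - F x)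
  (fun x => - F' x) _ e a c _ _ _ _ ea ac) _.
- by move=> x ex; have := dF x ex => ?; exact: is_deriveN.
- by move=> x ex; apply: cvgN; exact: cF'.
- by move=> x y ex xy; rewrite ltrN2; exact: decF.
- move=> x; apply: continuous_comp; last exact: cG.
  exact: opp_continuous.
- by apply: eq_integral => x _; rewrite /= opprK.
Qed.
End substitution.

(** * The norm along the limiting regression line *)

Section degenerate_norm.
Context (R : realType) (m1 m2 s1 s2 s : R).
Hypotheses (s10 : 0 < s1) (s20 : 0 < s2) (ss : s ^+ 2 = 1).

Let vs := varsigma s1 s2.
(** Minus the standardized abscissa of the point of the regression line that is
    closest to the origin; its square is lambda. *)
Definition line_shift := (m1 * s1 + s * m2 * s2) / vs.
(** The squared distance from the origin to the regression line, which is
    epsilon. *)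
Definition line_offset := (m2 * s1 - s * m1 * s2) ^+ 2 / vs.
(** The limit as rho tends to s of the conditional mean of the second coordinate
    given the first. *)
Definition line (x : R) := m2 + s * s2 / s1 * (x - m1).
Definition line_norm (x : R) : R := Num.sqrt (x ^+ 2 + line x ^+ 2).
(** The distance, in the standardized variable, from the point of the line
    closest to the origin to the points of the line at distance r from the
    origin. Since the square root vanishes on negative reals, it is 0 when the
    circle of radius r misses the line. *)
Definition line_radius (r : R) := Num.sqrt ((r ^+ 2 - line_offset) / vs).

Let vs0 : 0 < vs.
Proof. by rewrite addr_gt0// exprn_gt0. Qed.

Lemma line_offset_ge0 : 0 <= line_offset.
Proof. by rewrite divr_ge0 ?sqr_ge0// ltW. Qed.

(** Pythagoras: the distance to the origin splits into the distance along the
    line to the foot of the perpendicular and the distance to the line. *)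
Lemma line_normE x : line_norm x ^+ 2 =
  vs * ((x - m1) / s1 + line_shift) ^+ 2 + line_offset.
Proof.
rewrite sqr_sqrtr ?addr_ge0 ?sqr_ge0// /line_offset /line_shift /line.
have vsn0 : vs != 0 by rewrite gt_eqF.
have s1n0 : s1 != 0 by rewrite gt_eqF.
move: vsn0; rewrite /vs /varsigma.
have /orP[/eqP ->|/eqP ->] : (s == 1) || (s == -1) by rewrite -sqrf_eq1 ss.
  by move=> vsn0; field; rewrite vsn0 s1n0.
by move=> vsn0; field; rewrite vsn0 s1n0.
Qed.

Lemma ler_line_norm r x : 0 <= r -> line_offset <= r ^+ 2 ->
  (r <= line_norm x) = (line_radius r <= `|(x - m1) / s1 + line_shift|).
Proof.
move=> r0 rf; rewrite -[LHS]ler_sqr ?nnegrE ?sqrtr_ge0// line_normE.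
rewrite -[RHS]ler_sqr ?nnegrE ?sqrtr_ge0// sqr_sqrtr; last first.
  by rewrite divr_ge0 ?subr_ge0// ltW.
by rewrite real_normK ?num_real// ler_pdivrMr// lerBlDr mulrC.
Qed.

Lemma line_norm_ler r x : 0 <= r -> line_offset <= r ^+ 2 ->
  (line_norm x <= r) = (`|(x - m1) / s1 + line_shift| <= line_radius r).
Proof.
move=> r0 rf; rewrite -[LHS]ler_sqr ?nnegrE ?sqrtr_ge0// line_normE.
rewrite -[RHS]ler_sqr ?nnegrE ?sqrtr_ge0// [in RHS]sqr_sqrtr; last first.
  by rewrite divr_ge0 ?subr_ge0// ltW.
by rewrite real_normK ?num_real// ler_pdivlMr// lerBrDr mulrC.
Qed.

Let sqrt_line_offset r :
  Num.sqrt line_offset <= r -> 0 <= r /\ line_offset <= r ^+ 2.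
Proof.
move=> fr; have r0 : 0 <= r by exact: le_trans fr; exact: sqrtr_ge0.
split=> //; rewrite -(sqr_sqrtr line_offset_ge0).
by rewrite ler_sqr ?nnegrE ?sqrtr_ge0.
Qed.

(** For q = 1 and q = -1, the abscissas of the two intersections of the line with
    the circle of radius r, when they meet. For q = 0, the abscissa of the point
    of the line closest to the origin. *)
Definition branch (q r : R) := m1 + s1 * (q * line_radius r - line_shift).

Let le_branch q a x :
  (branch q a <= x) = (q * line_radius a <= (x - m1) / s1 + line_shift).
Proof.
by rewrite /branch addrC -lerBrDr [s1 * _]mulrC -ler_pdivlMr// lerBlDr.
Qed.

Let branch_le q a x :
  (x <= branch q a) = ((x - m1) / s1 + line_shift <= q * line_radius a).
Proof.
by rewrite /branch [m1 + _]addrC -lerBlDr [s1 * _]mulrC -ler_pdivrMr// lerBrDr.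
Qed.

Lemma line_radius_ge0 r : 0 <= line_radius r. Proof. exact: sqrtr_ge0. Qed.

Lemma line_norm_itvcc a c : Num.sqrt line_offset <= a -> a <= c ->
  [set x | a <= line_norm x <= c] =
  `[branch 1 a, branch 1 c] `|` `[branch (-1) c, branch (-1) a].
Proof.
move=> fa ac; have [a0 fa2] := sqrt_line_offset fa.
have [c0 fc2] := sqrt_line_offset (le_trans fa ac).
apply/seteqP; split=> x /=; rewrite !in_itv/= !le_branch !branch_le.
  rewrite ler_line_norm// line_norm_ler//.
  move: (_ / s1 + _) (line_radius_ge0 a) => z ha /andP[].
  rewrite ler_normr ler_norml => /orP[az|az] /andP[cz zc].
    by left; rewrite mul1r az mul1r.
  by right; rewrite !mulN1r cz lerNr.
rewrite ler_line_norm// line_norm_ler// !mul1r !mulN1r.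
have ha := line_radius_ge0 a; have hc := line_radius_ge0 c.
rewrite ler_normr ler_norml.
move: (_ / s1 + _) => z.
move=> [|] /andP[h1 h2]; apply/andP; split.
- by apply/orP; left; lra.
- by apply/andP; split; lra.
- by apply/orP; right; lra.
- by apply/andP; split; lra.
Qed.

Let e := Num.sqrt line_offset.
(* The derivative of [branch q]. *)
Let dbranch (q r : R) := s1 * (q * (r / (vs * line_radius r))).

Let sqr_gt r : e < r -> 0 < (r ^+ 2 - line_offset) / vs.
Proof.
move=> er; rewrite divr_gt0// subr_gt0 -(sqr_sqrtr line_offset_ge0).
rewrite ltr_sqr ?nnegrE ?sqrtr_ge0//.
by apply: ltW; apply: le_lt_trans er; exact: sqrtr_ge0.
Qed.

Lemma line_radius_gt0 r : e < r -> 0 < line_radius r.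
Proof. by move=> er; rewrite sqrtr_gt0 sqr_gt. Qed.

Lemma is_derive_line_radius r : e < r ->
  is_derive r 1 line_radius (r / (vs * line_radius r)).
Proof.
move=> er; have h0 := line_radius_gt0 er.
pose p (y : R) := (y ^+ 2 - line_offset) / vs.
have dp : is_derive r 1 p (2 * r / vs).
  rewrite /p; apply: is_derive_eq.
  by rewrite scaler0 add0r subr0 /GRing.scale/= mulr1 mulrC; ring.
have ds : is_derive (p r) 1 Num.sqrt (2 * Num.sqrt (p r))^-1.
  by apply: is_derive1_sqrt; exact: sqr_gt.
have dc : is_derive r 1 line_radius ((2 * Num.sqrt (p r))^-1 * (2 * r / vs)).
  exact: (is_derive1_comp ds dp).
apply: (is_derive_eq dc); rewrite -/(line_radius r).
by field; rewrite !gt_eqF.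
Qed.

Lemma is_derive_branch q r : e < r -> is_derive r 1 (branch q) (dbranch q r).
Proof.
move=> er; have dh := is_derive_line_radius er.
rewrite /branch; apply: is_derive_eq.
by rewrite /dbranch add0r subr0 mul1r.
Qed.

Lemma continuous_dbranch q r : e < r -> dbranch q y @[y --> r] --> dbranch q r.
Proof.
move=> er; have dh := is_derive_line_radius er.
have ch : line_radius y @[y --> r] --> line_radius r.
  apply: differentiable_continuous; apply/derivable1_diffP.
  exact: (@ex_derive _ _ _ _ _ _ _ dh).
apply: cvgM; first exact: cvg_cst.
apply: cvgM; first exact: cvg_cst.
apply: cvgM; first exact: cvg_id.
apply: cvgV; first by rewrite mulf_neq0 ?gt_eqF// line_radius_gt0.
by apply: cvgM => //; exact: cvg_cst.
Qed.

Lemma line_radius_lt x y : e < x -> x < y -> line_radius x < line_radius y.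
Proof.
move=> ex xy; rewrite ltr_sqrt; last exact/sqr_gt/(lt_trans ex).
rewrite ltr_pM2r ?invr_gt0// ltrD2r ltr_sqr ?nnegrE//; apply: ltW.
  by apply: le_lt_trans ex; exact: sqrtr_ge0.
by apply: lt_trans xy; apply: le_lt_trans ex; exact: sqrtr_ge0.
Qed.

Let branch1_lt x y : e < x -> x < y -> branch 1 x < branch 1 y.
Proof. by move=> ex xy; rewrite ltrD2l ltr_pM2l// ltrD2r !mul1r line_radius_lt. Qed.

Let branchN1_lt x y : e < x -> x < y -> branch (-1) y < branch (-1) x.
Proof.
by move=> ex xy; rewrite ltrD2l ltr_pM2l// ltrD2r !mulN1r ltrN2 line_radius_lt.
Qed.

(** The density transported through the two branches. The second derivative is
    taken with a minus sign because that branch is decreasing. *)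
Lemma f_R_branch r : e < r ->
  f_R (line_shift ^+ 2) vs line_offset r =
  normal_pdf m1 s1 (branch 1 r) * dbranch 1 r +
  normal_pdf m1 s1 (branch (-1) r) * - dbranch (-1) r.
Proof.
move=> er; have h0 := line_radius_gt0 er; have p0 := sqr_gt er.
(* all terms of [f_R] are rewritten in terms of [line_radius r] *)
have hE : (r ^+ 2 - line_offset) / vs = line_radius r ^+ 2.
  by rewrite sqr_sqrtr// ltW.
have sqrt2pi : Num.sqrt (2 / pi) = 2 / Num.sqrt (pi *+ 2) :> R.
  have pi0 := pi_gt0 R; have pi20 : 0 < pi *+ 2 :> R by rewrite mulrn_wgt0.
  apply/eqP; rewrite -(@eqrXn2 _ 2)// ?divr_ge0 ?sqrtr_ge0//.
  rewrite exprMn exprVn !sqr_sqrtr ?divr_ge0 ?ltW//; apply/eqP.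
  by clear pi20; move: (pi : R) pi0 => P P0; field; rewrite gt_eqF.
rewrite /f_R sqrt2pi indicE mem_set//= mulr1 [2 * vs]mulrC.
rewrite (_ : (r ^+ 2 - line_offset) / (vs * 2) =
    (r ^+ 2 - line_offset) / vs / 2); last first.
  by rewrite invfM mulrA.
rewrite -[line_shift ^+ 2 * _ / _]mulrA hE powRN div1r powR12_sqrt ?sqr_ge0//.
rewrite [Num.sqrt (line_shift ^+ 2 * _)]sqrtrM ?sqr_ge0// !sqrtr_sqr (gtr0_norm h0).
rewrite /cosh !normal_pdfE ?gt_eqF// !normal_peakE// /normal_fun /branch.
(* the hyperbolic cosine is even, which removes the absolute value *)
have -> : expR (`|line_shift| * line_radius r) +
      expR (- (`|line_shift| * line_radius r)) =
    expR (line_shift * line_radius r) + expR (- (line_shift * line_radius r)).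
  have [b0|b0] := leP 0 line_shift; first by rewrite ger0_norm.
  by rewrite ltr0_norm// !mulNr opprK addrC.
have K0 : 0 < Num.sqrt (pi *+ 2) :> R by rewrite sqrtr_gt0 mulrn_wgt0// pi_gt0.
have expE (q : R) : q ^+ 2 = 1 ->
    - (m1 + s1 * (q * line_radius r - line_shift) - m1) ^+ 2 / (s1 ^+ 2 *+ 2) =
    (- (line_radius r ^+ 2 / 2) - line_shift ^+ 2 / 2) + q * (line_shift * line_radius r).
  move: (line_radius r) line_shift => h b q2.
  rewrite (_ : - _ / _ = - (q ^+ 2 * h ^+ 2 / 2) - b ^+ 2 / 2 + q * (b * h)).
    by rewrite q2 mul1r.
  by field; rewrite gt_eqF.
rewrite !expE ?sqrrN ?expr1n// !expRD mul1r mulN1r /dbranch.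
move: (expR (line_shift * line_radius r)) (expR (- (line_shift * line_radius r)))
  (expR (- (line_radius r ^+ 2 / 2))) (expR (- (line_shift ^+ 2 / 2))) => u v w z.
clear expE sqrt2pi hE p0; move: (line_radius r) h0 (Num.sqrt _) K0 => h h0 k k0.
by field; rewrite !gt_eqF.
Qed.

Lemma measurable_line_norm : measurable_fun [set: R] line_norm.
Proof.
apply: measurableT_comp.
  by apply: continuous_measurable_fun; exact: sqrt_continuous.
apply: measurable_funD; apply: measurable_funX => //.
by apply: measurable_funD => //; apply: measurable_funM => //; exact: measurable_funB.
Qed.

(* The normal law lives on the type copy [measurableTypeR R] of R, and an
   instance of measurable function on it is keyed on that domain type. *)
Let line_rv : measurableTypeR R -> R := line_norm.

HB.instance Definition _ :=
  @isMeasurableFun.Build _ _ _ _ line_rv measurable_line_norm.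

Definition line_law : probability R R := distribution (normal_prob m1 s1) line_rv.

Lemma line_lawE A : line_law A = normal_prob m1 s1 (line_norm @^-1` A).
Proof. by []. Qed.

Let line_radius_e : line_radius e = 0.
Proof. by rewrite /line_radius sqr_sqrtr ?line_offset_ge0// subrr mul0r sqrtr0. Qed.

(** The line stays outside the open disk of radius e and touches its closure in
    one point, which is null. *)
Lemma line_law_le_line_offset : line_law `]-oo, e]%classic = 0%E.
Proof.
have [e0 fe] := sqrt_line_offset (lexx e).
rewrite line_lawE.
rewrite (_ : _ @^-1` _ = [set branch 0 e]).
  by rewrite /normal_prob integral_set1.
apply/seteqP; split=> x /=; rewrite in_itv/= line_norm_ler// line_radius_e.
  rewrite normr_le0 => /eqP xe; apply/eqP.
  by rewrite eq_le le_branch branch_le xe mul0r lexx.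
move=> /eqP; rewrite eq_le le_branch branch_le mul0r -eq_le => /eqP ->.
by rewrite normr0.
Qed.

Lemma line_law_itvcc a c : e < a ->
  line_law `[a, c]%classic =
  (\int[lebesgue_measure]_(r in `[a, c])
    (f_R (line_shift ^+ 2) vs line_offset r)%:E)%E.
Proof.
move=> ea; have [ac|ca] := leP a c; last first.
  by rewrite set_itv_ge ?bnd_simp -?ltNge// measure0 integral_set0.
rewrite line_lawE.
rewrite (_ : _ @^-1` _ = [set x | a <= line_norm x <= c]); last first.
  by apply/seteqP; split=> x /=; rewrite in_itv.
rewrite line_norm_itvcc ?(ltW ea)// measureU//; last first.
  rewrite -subset0 => x [/=]; rewrite !in_itv/= !le_branch !branch_le.
  rewrite !mul1r !mulN1r => /andP[h1 _] /andP[_ h2].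
  by have := line_radius_gt0 ea; have := le_trans h1 h2; rewrite lerNr; lra.
have cpdf : continuous (normal_pdf m1 s1).
  by apply: continuous_normal_pdf; rewrite gt_eqF.
transitivity (\int[lebesgue_measure]_(x in `[branch 1 a, branch 1 c])
    (normal_pdf m1 s1 x)%:E + \int[lebesgue_measure]_(x in
    `[branch (-1) c, branch (-1) a]) (normal_pdf m1 s1 x)%:E)%E; first by [].
rewrite (integration_by_substitution_itv_gt (is_derive_branch 1)
  (@continuous_dbranch 1) branch1_lt cpdf ea ac).
rewrite (integration_by_substitution_itv_gtN (is_derive_branch (-1))
  (@continuous_dbranch (-1)) branchN1_lt cpdf ea ac).
have mterm q : measurable_fun `[a, c]
    (fun x => normal_pdf m1 s1 (branch q x) * dbranch q x).
  apply: subspace_continuous_measurable_fun => //.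
  apply: continuous_in_subspaceT => x; rewrite inE/= in_itv/= => /andP[ax _].
  have ex : e < x by exact: lt_le_trans ax.
  apply: cvgM; last exact: continuous_dbranch.
  have cb : branch q y @[y --> x] --> branch q x.
    apply: differentiable_continuous; apply/derivable1_diffP.
    exact: (@ex_derive _ _ _ _ _ _ _ (is_derive_branch q ex)).
  exact: (cvg_comp _ _ cb (cpdf _)).
have dbranch_ge0 x : e < x -> 0 <= dbranch 1 x.
  move=> ex; have h0 := line_radius_gt0 ex.
  rewrite /dbranch mul1r mulr_ge0 ?(ltW s10)// divr_ge0 ?mulr_ge0 ?(ltW vs0) ?(ltW h0)//.
  by apply: ltW; apply: le_lt_trans ex; exact: sqrtr_ge0.
rewrite -ge0_integralD//; first last.
- apply/measurable_EFinP; apply: eq_measurable_fun (measurable_funN (mterm (-1))).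
  by move=> x _; rewrite /= mulrN.
- move=> x; rewrite /= in_itv/= => /andP[ax _].
  rewrite lee_fin mulr_ge0 ?normal_pdf_ge0// /dbranch mulN1r mulrN opprK.
  have := dbranch_ge0 x (lt_le_trans ea ax); rewrite /dbranch mul1r//.
- by apply/measurable_EFinP; exact: (mterm 1).
- move=> x; rewrite /= in_itv/= => /andP[ax _].
  by rewrite lee_fin mulr_ge0 ?normal_pdf_ge0// dbranch_ge0// (lt_le_trans ea).
apply: eq_integral => x; rewrite inE/= in_itv/= => /andP[ax _].
by rewrite f_R_branch ?EFinD// (lt_le_trans ea).
Qed.

(** A line meets a circle in at most two points. *)
Lemma null_line_norm_eq r : lebesgue_measure [set x | line_norm x = r] = 0%E.
Proof.
apply: countable_lebesgue_measure0; apply: finite_set_countable.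
apply: (@sub_finite_set _ _ [set branch 1 r; branch (-1) r]); last first.
  exact: finite_set2.
move=> x /= xr; have r0 : 0 <= r by rewrite -xr sqrtr_ge0.
have fr : line_offset <= r ^+ 2.
  by rewrite -xr line_normE lerDr mulr_ge0 ?sqr_ge0// ltW.
have h1 : r <= line_norm x by rewrite xr.
have h2 : line_norm x <= r by rewrite xr.
move: h1 h2; rewrite ler_line_norm// line_norm_ler// => h1 h2.
have hE := le_anti (introT andP (conj h1 h2)).
have [b0|b0] := leP 0 ((x - m1) / s1 + line_shift).
  left; rewrite ger0_norm// in hE; apply/eqP.
  by rewrite eq_le le_branch branch_le mul1r hE lexx.
right; rewrite ltr0_norm// in hE; apply/eqP.
by rewrite eq_le le_branch branch_le mulN1r hE opprK lexx.
Qed.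

End degenerate_norm.

(** * The limiting density *)

Section f_R_basic.
Context (R : realType).
Implicit Types l v e : R.

Lemma measurable_f_R l v e : measurable_fun [set: R] (f_R l v e).
Proof.
have mw : measurable_fun [set: R] (fun r : R => r ^+ 2 - e).
  by apply: measurable_funB => //; exact: measurable_funX.
have mexp : measurable_fun [set: R] (@expR R) by [].
have mcosh : measurable_fun [set: R] (@cosh R).
  apply: measurable_funM => //; apply: measurable_funD => //.
  by apply: measurableT_comp => //; exact: measurable_oppr.
have msqrt : measurable_fun [set: R] (@Num.sqrt R).
  by apply: continuous_measurable_fun; exact: sqrt_continuous.
apply: measurable_funM; last first.
  apply: measurable_indic.
  rewrite (_ : [set t | _] = `]Num.sqrt e, +oo[%classic); first exact: measurable_itv.
  by apply/seteqP; split => x /=; rewrite in_itv/= andbT.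
apply: measurable_funM; last first.
  apply: (measurableT_comp mcosh); apply: (measurableT_comp msqrt).
  by apply: measurable_funM => //; exact: measurable_funM.
apply: measurable_funM; last first.
  apply: (measurableT_comp mexp); apply: measurable_funB => //.
  by apply: measurableT_comp => //; exact: measurable_funM.
apply: measurable_funM.
  by apply: measurable_funM => //; exact: measurable_funM.
apply: (measurableT_comp (measurable_powR _)).
exact: measurable_funM.
Qed.

Lemma f_R_ge0 l v e r : 0 < v -> 0 <= f_R l v e r.
Proof.
move=> v0; rewrite /f_R indicE.
have [|_] := boolP (r \in _); last by rewrite mulr0.
rewrite inE /= => er; have r0 : 0 < r by apply: le_lt_trans er; exact: sqrtr_ge0.
rewrite !mulr_ge0 ?sqrtr_ge0 ?powR_ge0 ?expR_ge0 ?invr_ge0 ?ltW//.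
Qed.

Lemma f_R_eq0 l v e r : r <= Num.sqrt e -> f_R l v e r = 0.
Proof.
move=> re; rewrite /f_R indicE memNset ?mulr0//.
by rewrite /= ltNge re.
Qed.
End f_R_basic.

Section limit_law.
Context (R : realType) (m1 m2 s1 s2 s : R).
Hypotheses (s10 : 0 < s1) (s20 : 0 < s2) (ss : s ^+ 2 = 1).

Lemma has_density_line_law :
  has_density (line_law m1 m2 s1 s2 s)
    (f_R (line_shift m1 m2 s1 s2 s ^+ 2) (varsigma s1 s2) (line_offset m1 m2 s1 s2 s)).
Proof.
apply: (@has_density_itvcc _ _ _ _ _ (Num.sqrt (line_offset m1 m2 s1 s2 s))).
- exact: measurable_f_R.
- by move=> x; apply: f_R_ge0; rewrite addr_gt0// exprn_gt0.
- exact: line_law_le_line_offset.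
- by move=> x; exact: f_R_eq0.
- by move=> a c; exact: line_law_itvcc.
Qed.

Let sgs : Num.sg s = s.
Proof.
have /orP[/eqP ->|/eqP ->] : (s == 1) || (s == -1) by rewrite -sqrf_eq1 ss.
  by rewrite sgr1.
by rewrite sgrN1.
Qed.

Lemma lambda_line_shift : lambda m1 m2 s1 s2 s = line_shift m1 m2 s1 s2 s ^+ 2.
Proof.
rewrite /lambda /line_shift sgs exprMn exprVn mulrC; congr (_ / _).
transitivity (m1 ^+ 2 * s1 ^+ 2 + s ^+ 2 * (m2 ^+ 2 * s2 ^+ 2)
   + 2 * m1 * m2 * s1 * s2 * s); first by rewrite ss mul1r.
by ring.
Qed.

Lemma epsilon_line_offset : epsilon m1 m2 s1 s2 s = line_offset m1 m2 s1 s2 s.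
Proof.
rewrite /epsilon /line_offset sgs mulrC; congr (_ / _).
transitivity (m2 ^+ 2 * s1 ^+ 2 + s ^+ 2 * (m1 ^+ 2 * s2 ^+ 2)
   - 2 * m1 * m2 * s1 * s2 * s); first by rewrite ss mul1r.
by ring.
Qed.

Context (d : R -> measure_display) (T : forall rho : R, measurableType (d rho))
  (P : forall rho : R, probability (T rho) R)
  (X : forall rho : R, {RV (P rho) >-> (R * R)%type}).
Hypothesis hX : forall rho : R, `|rho| < 1 ->
  is_binormal (P rho) (X rho) (col2 (m1, m2)) (covmx2 s1 s2 rho).

(** Limits at [1^'-] and [-1^'+] are tested on sequences, whose terms satisfy
    [`|u n| < 1] only eventually; a shift of the index makes it hold throughout
    so that the dominated convergence theorem applies. *)
Lemma cvg_cdf_rvnorm (u : R^nat) (r : R) : u @ \oo --> s ->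
  (\forall n \near \oo, `|u n| < 1) ->
  cdf (rvnorm (X (u n)) : {RV (P (u n)) >-> R}) r @[n --> \oo] -->
  line_law m1 m2 s1 s2 s `]-oo, r]%classic.
Proof.
move=> us [n0 _ u1].
pose N (x : R * R) := Num.sqrt (x.1 ^+ 2 + x.2 ^+ 2).
have mN : measurable_fun [set: R * R] N.
  apply: measurableT_comp.
    by apply: continuous_measurable_fun; exact: sqrt_continuous.
  by apply: measurable_funD; apply: measurable_funX.
have cN (x : R) : continuous (fun y => N (x, y)).
  move=> y.
  have cq : x ^+ 2 + z ^+ 2 @[z --> y] --> x ^+ 2 + y ^+ 2.
    by apply: cvgD; [exact: cvg_cst|exact: sqr_continuous].
  have := cvg_comp _ _ cq (@sqrt_continuous R _).
  by [].
have cdfE rho : `|rho| < 1 -> cdf (rvnorm (X rho) : {RV (P rho) >-> R}) r =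
    (\int[lebesgue_measure \x lebesgue_measure]_(x in [set x | (N x <= r)%R])
      (binormal_pdf (col2 (m1, m2)) (covmx2 s1 s2 rho) x)%:E)%E.
  move=> rho1; rewrite -(hX rho1).
    by rewrite /cdf /distribution /pushforward; congr (P rho _).
  rewrite -[X in measurable X]setTI (_ : [set x | N x <= r] = N @^-1` `]-oo, r]%classic).
    by apply: mN => //; exact: measurable_itv.
  by apply/seteqP; split => x /=; rewrite in_itv.
rewrite -(cvg_shiftn n0).
have u1' n : `|u (n + n0)%N| < 1 by apply: u1; rewrite /= leq_addl.
have us' : (fun n => u (n + n0)%N) @ \oo --> s by rewrite cvg_shiftn.
under eq_fun => n do rewrite cdfE//.
rewrite line_lawE (_ : _ @^-1` _ = [set x | line_norm m1 m2 s1 s2 s x <= r]); last first.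
  by apply/seteqP; split => x /=; rewrite in_itv.
apply: (@cvg_integral_binormal_pdf R m1 m2 s1 s2 s N) => //.
exact: null_line_norm_eq.
Qed.
End limit_law.

Theorem claim4 (R : realType) (mu1 mu2 sigma1 sigma2 : R)
    (hsigma1 : 0 < sigma1) (hsigma2 : 0 < sigma2)
    (d : R -> measure_display) (T : forall rho : R, measurableType (d rho))
    (P : forall rho : R, probability (T rho) R)
    (X : forall rho : R, {RV (P rho) >-> (R * R)%type})
    (hX : forall rho : R, `|rho| < 1 ->
       is_binormal (P rho) (X rho) (col2 (mu1, mu2)) (covmx2 sigma1 sigma2 rho)) :
  limiting_density 1^'- P (fun rho => rvnorm (X rho))
    (f_R (lambda mu1 mu2 sigma1 sigma2 1) (varsigma sigma1 sigma2)
         (epsilon mu1 mu2 sigma1 sigma2 1)) /\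
  limiting_density (-1)^'+ P (fun rho => rvnorm (X rho))
    (f_R (lambda mu1 mu2 sigma1 sigma2 (-1)) (varsigma sigma1 sigma2)
         (epsilon mu1 mu2 sigma1 sigma2 (-1))).
Proof.
have ss1 : (1 : R) ^+ 2 = 1 by rewrite expr1n.
have ssN1 : (-1 : R) ^+ 2 = 1 by rewrite sqrrN expr1n.
rewrite !lambda_line_shift// !epsilon_line_offset//; split.
- exists (line_law mu1 mu2 sigma1 sigma2 1); split; first exact: has_density_line_law.
  move=> r _.
  have fin := fin_num_measure (line_law mu1 mu2 sigma1 sigma2 1) _
    (measurable_itv `]-oo, r]).
  rewrite -(fineK fin); apply/cvge_at_leftP => u [u1 cu]; rewrite fineK//.
  apply: (@cvg_cdf_rvnorm R mu1 mu2 sigma1 sigma2 1) => //.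
  near=> n; rewrite ltr_norml u1 andbT; near: n.
  by apply: (cvgr_gt _ cu); lra.
- exists (line_law mu1 mu2 sigma1 sigma2 (-1)); split; first exact: has_density_line_law.
  move=> r _.
  have fin := fin_num_measure (line_law mu1 mu2 sigma1 sigma2 (-1)) _
    (measurable_itv `]-oo, r]).
  rewrite -(fineK fin); apply/cvge_at_rightP => u [u1 cu]; rewrite fineK//.
  apply: (@cvg_cdf_rvnorm R mu1 mu2 sigma1 sigma2 (-1)) => //.
  near=> n; rewrite ltr_norml u1 /=; near: n.
  by apply: (cvgr_lt _ cu); lra.
Unshelve. all: by end_near. Qed.
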